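(* Let $G$ be a Lie group acting effectively by isometries on a connected Riemannian manifold $(M,g)$, with Lie algebra $\mathfrak{g}$ identified with a Lie algebra of Killing vector fields on $(M,g)$. Let $X\in\mathfrak{g}$ be a Killing vector field of constant length on $(M,g)$ and let $L=\operatorname{ad}(X):\mathfrak g\to\mathfrak g$. Then the following assertions hold. 1) There is an $L$-invariant linear space decomposition $\mathfrak{g}=A_1\oplus A_2$, where $A_1=\operatorname{Ker}(L^2)$ and $A_2=\operatorname{Im}(L^2)$. Moreover, $A_1$ is the root space (generalized eigenspace) for $L$ with the eigenvalue $0$, and $L$ is invertible on $A_2$. 2) If $\mathfrak{o}\subset\mathfrak g$ is a $2$-dimensional $L$-invariant subspace corresponding to a complex conjugate pair of eigenvalues $\alpha\pm\beta\mathbf{i}$ ($\alpha,\beta\in\mathbb R$, $\beta\neq 0$, $\mathbf i=\sqrt{-1}$), i.e. $L(U)=\alpha U-\beta V$ and $L(V)=\beta U+\alpha V$ for some non-trivial $U,V\in\mathfrak{o}$, then $\alpha=0$, $g(U,V)=0$ and $g(U,U)=g(V,V)$ on $M$. 3) All eigenvalues of $L$ have trivial real parts.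
   Context: Each $U\in\mathfrak{g}$ is identified with the Killing vector field $\widetilde U$ on $M$ given by $\widetilde{U}(x)=\frac{d}{dt}\exp(tU)(x)\big|_{t=0}$. The map $U\mapsto\widetilde U$ is linear and injective, and $[\widetilde U,\widetilde V]=-\widetilde{[U,V]_{\mathfrak g}}$, where $[\cdot,\cdot]_{\mathfrak g}$ is the Lie bracket of $\mathfrak g$ and $[\cdot,\cdot]$ is the Lie bracket of vector fields; under the identification, $[\cdot,\cdot]$ denotes the bracket of vector fields and $\operatorname{ad}(X)(Y)=[X,Y]$. For $U,V\in\mathfrak g$, $g(U,V)$ denotes the function $x\mapsto g_x(U(x),V(x))$ on $M$. $X$ has constant length if the function $g(X,X)$ is constant on $M$. Eigenvalues of $L$ are understood as complex eigenvalues (of the complexification). *)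

(* Defs.v *)
From HB Require Import structures.
From mathcomp Require Import all_boot all_order all_algebra.
From mathcomp Require Import all_classical all_reals all_analysis.
From mathcomp Require Import complex.

Set Implicit Arguments.
Unset Strict Implicit.
Unset Printing Implicit Defensive.

Import Order.TTheory GRing.Theory Num.Theory.
Import numFieldNormedType.Exports.

Local Open Scope classical_set_scope.
Local Open Scope ring_scope.

#[short(type="topGroupType")]
HB.structure Definition TopGroup := {G of Topological G & Group G}.

(* A k-times continuously differentiable function on an open set A: all iterated
   partial derivatives up to order k exist and are continuous on A. *)
Fixpoint Ck_on (R : realType) (n : nat) (V : normedModType R) (k : nat)
    (A : set 'rV[R]_n) (f : 'rV[R]_n -> V) : Prop :=
  (forall x, A x -> {for x, continuous f}) /\
  match k with
  | 0 => True
  | k'.+1 => forall i : 'I_n,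
      (forall x, A x -> derivable f x (delta_mx 0 i)) /\
      Ck_on k' A ('D_(delta_mx 0 i) f)
  end.

Definition smooth_on (R : realType) (n : nat) (V : normedModType R)
    (A : set 'rV[R]_n) (f : 'rV[R]_n -> V) : Prop :=
  forall k, Ck_on k A f.

(* [cmap] and [cinv] are total functions; they are only meaningful on [cdom]
   and on [cim] respectively. *)
Record chart (R : realType) (T : Type) (n : nat) := Chart {
  cdom : set T;
  cmap : T -> 'rV[R]_n;
  cinv : 'rV[R]_n -> T }.

Definition cim (R : realType) (T : Type) (n : nat) (c : chart R T n) :
  set 'rV[R]_n := cmap c @` cdom c.

Record is_chart (R : realType) (T : topologicalType) (n : nat)
    (c : chart R T n) : Prop := {
  chart_dom_open : open (cdom c);
  chart_im_open : open (cim c);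
  chart_mapK : forall x, cdom c x -> cinv c (cmap c x) = x;
  chart_map_cont : forall x, cdom c x -> {for x, continuous (cmap c)};
  chart_inv_cont : forall y, cim c y -> {for y, continuous (cinv c)} }.

(* An atlas on M is presented as a family [c] indexed by the points of M, where
   [c x] is a chart around x. This chart is used to identify the tangent space
   at x with 'rV[R]_n. *)

Definition smooth_map (R : realType) (M N : topologicalType) (m n : nat)
    (cM : M -> chart R M m) (cN : N -> chart R N n) (F : M -> N) : Prop :=
  continuous F /\
  forall p q,
    smooth_on (cmap (cM p) @` (cdom (cM p) `&` F @^-1` cdom (cN q)))
              (cmap (cN q) \o F \o cinv (cM p)).

Record is_manifold (R : realType) (M : topologicalType) (n : nat)
    (c : M -> chart R M n) : Prop := {
  manifold_hausdorff : hausdorff_space M;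
  manifold_second_countable : @second_countable M;
  manifold_chart : forall x, is_chart (c x);
  manifold_center : forall x, cdom (c x) x;
  manifold_transition : forall p q,
    smooth_on (cmap (c p) @` (cdom (c p) `&` cdom (c q)))
              (cmap (c q) \o cinv (c p)) }.

Definition prod_chart (R : realType) (S T : Type) (m n : nat)
    (c : chart R S m) (d : chart R T n) : chart R (S * T)%type (m + n) :=
  Chart (cdom c `*` cdom d)
        (fun p => row_mx (cmap c p.1) (cmap d p.2))
        (fun y => (cinv c (lsubmx y), cinv d (rsubmx y))).

Definition prod_atlas (R : realType) (M N : Type) (m n : nat)
    (cM : M -> chart R M m) (cN : N -> chart R N n) (p : M * N) :
    chart R (M * N)%type (m + n) :=
  prod_chart (cM p.1) (cN p.2).

(* The differential T_x M -> T_(F x) N. *)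
Definition dmap (R : realType) (M N : Type) (m n : nat)
    (cM : M -> chart R M m) (cN : N -> chart R N n) (F : M -> N) (x : M)
    (v : 'rV[R]_m) : 'rV[R]_n :=
  'D_v (cmap (cN (F x)) \o F \o cinv (cM x)) (cmap (cM x) x).

(* A vector field maps x to an element of T_x M, i.e. to its components in the
   chart [c x]. *)
Definition vfield (R : realType) (M : Type) (n : nat) := M -> 'rV[R]_n.

(* The components of the vector field X in the chart [c p], as a function of
   the coordinates. *)
Definition vlocal (R : realType) (M : Type) (n : nat) (c : M -> chart R M n)
    (p : M) (X : vfield R M n) (y : 'rV[R]_n) : 'rV[R]_n :=
  let z := cinv (c p) y in
  'D_(X z) (cmap (c p) \o cinv (c z)) (cmap (c z) z).

(* [X, Y]^i = X^j d_j Y^i - Y^j d_j X^i, computed at p in the chart [c p]. *)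
Definition vbracket (R : realType) (M : Type) (n : nat) (c : M -> chart R M n)
    (X Y : vfield R M n) : vfield R M n :=
  fun p => 'D_(X p) (vlocal c p Y) (cmap (c p) p)
         - 'D_(Y p) (vlocal c p X) (cmap (c p) p).

(* A metric maps x to the Gram matrix of an inner product on T_x M. *)
Definition inner (R : realType) (M : Type) (n : nat) (g : M -> 'M[R]_n)
    (x : M) (u v : 'rV[R]_n) : R := (u *m g x *m v^T) 0 0.

Definition frame (R : realType) (M : Type) (n : nat) (c : M -> chart R M n)
    (p : M) (i : 'I_n) : vfield R M n :=
  fun z => 'D_(delta_mx 0 i) (cmap (c z) \o cinv (c p)) (cmap (c p) z).

Record is_riemannian_metric (R : realType) (M : Type) (n : nat)
    (c : M -> chart R M n) (g : M -> 'M[R]_n) : Prop := {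
  metric_sym : forall x u v, inner g x u v = inner g x v u;
  metric_pos : forall x u, u != 0 -> 0 < inner g x u u;
  metric_smooth : forall p i j,
    smooth_on (cim (c p)) (fun y => let z := cinv (c p) y in
                                    inner g z (frame c p i z) (frame c p j z)) }.

Record is_lie_group (R : realType) (G : topGroupType) (m : nat)
    (cG : G -> chart R G m) : Prop := {
  lie_group_manifold : is_manifold cG;
  lie_group_mul : smooth_map (prod_atlas cG cG) cG (fun p => (p.1 * p.2)%g);
  lie_group_inv : smooth_map cG cG (fun a => a^-1%g) }.

(* e is the exponential map of G, whose Lie algebra is identified with the
   tangent space 'rV[R]_m at 1: t |-> e (t U) is the one-parameter subgroup
   with velocity U at t = 0. *)
Definition is_lie_exp (R : realType) (G : topGroupType) (m : nat)
    (cG : G -> chart R G m) (e : 'rV[R]_m -> G) : Prop :=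
  forall U : 'rV[R]_m,
    [/\ forall s t : R, e ((s + t) *: U) = (e (s *: U) * e (t *: U))%g,
        continuous (fun t : R => e (t *: U))
      & is_derive (0 : R) (1 : R) (fun t : R => cmap (cG 1%g) (e (t *: U))) U].

Record is_smooth_action (R : realType) (G : topGroupType) (M : topologicalType)
    (m n : nat) (cG : G -> chart R G m) (cM : M -> chart R M n)
    (act : G -> M -> M) : Prop := {
  action1 : forall x, act 1%g x = x;
  actionM : forall a b x, act (a * b)%g x = act a (act b x);
  action_smooth : smooth_map (prod_atlas cG cM) cM (fun p => act p.1 p.2) }.

Definition effective_action (G : topGroupType) (M : Type) (act : G -> M -> M) :
  Prop := forall a, (forall x, act a x = x) -> a = 1%g.

Definition isometric_action (R : realType) (G M : Type) (n : nat)
    (cM : M -> chart R M n) (g : M -> 'M[R]_n) (act : G -> M -> M) : Prop :=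
  forall a x u v,
    inner g (act a x) (dmap cM cM (act a) x u) (dmap cM cM (act a) x v) =
    inner g x u v.

(* The vector field x |-> d/dt (exp (t U) x) at t = 0. *)
Definition fundamental_field (R : realType) (G M : Type) (m n : nat)
    (e : 'rV[R]_m -> G) (cM : M -> chart R M n) (act : G -> M -> M)
    (U : 'rV[R]_m) : vfield R M n :=
  fun x => 'D_(1 : R) (fun t : R => cmap (cM x) (act (e (t *: U)) x)) 0.

(* The Lie algebra of G, identified with a set of vector fields on M. *)
Definition lie_algebra (R : realType) (G M : Type) (m n : nat)
    (e : 'rV[R]_m -> G) (cM : M -> chart R M n) (act : G -> M -> M) :
    set (M -> 'rV[R]_n) :=
  range (fundamental_field e cM act).

Definition constant_length (R : realType) (M : Type) (n : nat)
    (g : M -> 'M[R]_n) (X : vfield R M n) : Prop :=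
  exists r : R, forall x, inner g x (X x) (X x) = r.

Section LinearAlgebra.
Variables (R : realType) (E : lmodType R).
Implicit Types (W A B : set E) (L : E -> E).

Definition subspace A : Prop :=
  A 0 /\ forall (a : R) u v, A u -> A v -> A (a *: u + v).

Definition direct_sum W A B : Prop :=
  [/\ subspace A, subspace B, A `&` B = [set 0]
    & W = [set w | exists u v, [/\ A u, B v & w = u + v]]].

Definition two_dimensional A : Prop :=
  exists u v : E,
    (forall a b : R, a *: u + b *: v = 0 -> a = 0 /\ b = 0) /\
    A = [set w | exists a b : R, w = a *: u + b *: v].

Definition invariant_under L A : Prop := forall u, A u -> A (L u).

Definition ker2_on W L : set E := [set u | W u /\ L (L u) = 0].

Definition im2_on W L : set E := [set L (L u) | u in W].

Definition root_space0 W L : set E :=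
  [set u | W u /\ exists k, iter k L u = 0].

(* z is an eigenvalue of the complexification of L : W -> W, with eigenvector
   U + iV, that is, L U + i L V = z (U + iV). *)
Definition complex_eigenvalue W L (z : R[i]) : Prop :=
  exists U V : E,
    [/\ W U, W V, U <> 0 \/ V <> 0,
        L U = complex.Re z *: U - complex.Im z *: V
      & L V = complex.Im z *: U + complex.Re z *: V].

End LinearAlgebra.

(* Main.v *)
Require Import Defs.
From HB Require Import structures.
From mathcomp Require Import all_boot all_order all_algebra.
From mathcomp Require Import all_classical all_reals all_analysis.
From mathcomp Require Import complex ring lra.

Set Implicit Arguments.
Unset Strict Implicit.
Unset Printing Implicit Defensive.

Import Order.TTheory GRing.Theory Num.Theory.
Import numFieldNormedType.Exports.

Local Open Scope classical_set_scope.
Local Open Scope ring_scope.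

(* Write [tau U] for the fundamental field of [U] and [ad U V] for the derivative
   of Ad (exp tU) V at t = 0. Equivariance d(a)(tau V) = tau (Ad a V) o a,
   differentiated along a = exp tU, gives [tau U, tau V] = - tau (ad U V), so the
   Killing fields are stable under the bracket; combined with the invariance of g
   it shows that g([Z,U],V) + g(U,[Z,V]) = 0 whenever g(U,V) is constant.
   For X of constant length, g([Z,X],X) = 0; differentiating again and using the
   antisymmetry of the bracket yields the identity
     g(L A, L^2 B) + g(L B, L^2 A) = 0
   from which everything follows. B = L A shows that L^3 A = 0 implies L^2 A = 0,
   whence the Fitting decomposition at exponent 2; applied to eigenvectors, which
   lie in the image of L when the eigenvalue is nonzero, it shows that the real
   part vanishes and that U, V are orthogonal of equal length. *)

(** * Calculus on coordinate spaces *)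

Section Calculus.
Variable R : realType.

Lemma is_derive_mx (V : normedModType R) m n (M : V -> 'M[R]_(m, n)) t v (D : 'M[R]_(m, n)) :
  (forall i j, is_derive t v (fun x => M x i j) (D i j)) -> is_derive t v M D.
Proof.
move=> dM.
have dMt : derivable M t v by apply/derivable_mxP => i j; have [] := dM i j.
split=> //; rewrite derive_mx//; apply/matrixP => i j; rewrite mxE.
by have [_ ->] := dM i j.
Qed.

Lemma is_derive_mx_coord (V : normedModType R) m n (M : V -> 'M[R]_(m, n)) t v
    (D : 'M[R]_(m, n)) i j :
  is_derive t v M D -> is_derive t v (fun x => M x i j) (D i j).
Proof.
move=> [dM <-]; split; first by move/derivable_mxP: dM.
by rewrite derive_mx// mxE.
Qed.

Lemma is_derive_scale m n (a : R -> R) (F : R -> 'M[R]_(m, n)) (t a' : R) (F' : 'M[R]_(m, n)) :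
  is_derive t 1 a a' -> is_derive t 1 F F' ->
  is_derive t 1 (fun s => a s *: F s) (a' *: F t + a t *: F').
Proof.
move=> da dF; apply: is_derive_mx => i j.
have dFij := is_derive_mx_coord i j dF.
have -> : (fun x => (a x *: F x) i j) = a * (fun x => F x i j).
  by apply/funext => x; rewrite mxE.
by apply: is_derive_eq; rewrite !mxE addrC /GRing.scale/= [F t i j * _]mulrC.
Qed.

(** Chain rule along a curve. The base point is passed through the equation [c t = y], so that it
    can be given in simplified form, such as the coordinates of the unit instead of those of
    [e (0 *: U)]. *)
Lemma is_derive_curve (V W : normedModType R) (f : V -> W) (c : R -> V) (t : R) y (c' : V) :
  c t = y -> differentiable f y -> is_derive t 1 c c' ->
  is_derive t 1 (fun s => f (c s)) ('D_c' f y).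
Proof.
move=> <- df [/derivable1_diffP dc <-].
have dfc : differentiable (f \o c) t by exact: differentiable_comp.
split; first exact/derivable1_diffP.
by rewrite -[LHS]/('D_1 (f \o c) t) !deriveE// diff_comp.
Qed.

Lemma derive_line (V W : normedModType R) (f : V -> W) y v (t : R) :
  derivable f (y + t *: v) v ->
  is_derive t 1 (fun s : R => f (y + s *: v)) ('D_v f (y + t *: v)).
Proof.
have E : (fun h : R => h^-1 *: (((fun s : R => f (y + s *: v)) \o shift t) (h *: 1)
       - f (y + t *: v)))
   = (fun h => h^-1 *: ((f \o shift (y + t *: v)) (h *: v) - f (y + t *: v))).
  apply/funext => h /=; congr (_ *: (f _ - _)).
  by rewrite [h *: 1]mulr1 scalerDl addrCA.
by move=> df; split; rewrite /derivable /derive E.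
Qed.

(** The one-variable mean value theorem on the segment between 0 and [s], whichever comes first.
    Bounding by absolute values gives one conclusion for both signs of [s]. *)
Lemma MVT_line (V : normedModType R) (f : V -> R) y v (s : R) :
  (forall t, `|t| <= `|s| -> derivable f (y + t *: v) v) ->
  exists2 c, `|c| <= `|s| & f (y + s *: v) - f y = s * 'D_v f (y + c *: v).
Proof.
move=> df; have y0 : f y = f (y + 0 *: v) by rewrite scale0r addr0.
have dfc (a b : R) : (forall t, a <= t <= b -> `|t| <= `|s|) ->
    {within `[a, b], continuous (fun t : R => f (y + t *: v))}.
  move=> ab; apply: derivable_within_continuous => t; rewrite in_itv/= => /ab /df.
  by move=> /derive_line [].
case: (ltgtP s 0) => [s0|s0|->]; last first.
- by exists 0; rewrite ?normr0// mul0r y0 subrr.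
- have st t : 0 <= t <= s -> `|t| <= `|s|.
    by move=> /andP[t0 ts]; rewrite !ger0_norm// ltW.
  have [|c cs E] := @MVT _ (fun t => f (y + t *: v)) (fun t => 'D_v f (y + t *: v))
    _ _ s0 _ (dfc _ _ st).
    move=> t; rewrite in_itv/= => /andP[t0 ts]; apply: derive_line; apply: df.
    by apply: st; rewrite !ltW.
  exists c; last by rewrite y0 E subr0 mulrC.
  by apply: st; move: cs; rewrite in_itv/= => /andP[? ?]; rewrite !ltW.
- have st t : s <= t <= 0 -> `|t| <= `|s|.
    by move=> /andP[t0 ts]; rewrite !ler0_norm ?lerN2// ltW.
  have [|c cs E] := @MVT _ (fun t => f (y + t *: v)) (fun t => 'D_v f (y + t *: v))
    _ _ s0 _ (dfc _ _ st).
    move=> t; rewrite in_itv/= => /andP[t0 ts]; apply: derive_line; apply: df.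
    by apply: st; rewrite !ltW.
  exists c; last by rewrite y0 -opprB E sub0r mulrN opprK mulrC.
  by apply: st; move: cs; rewrite in_itv/= => /andP[? ?]; rewrite !ltW.
Qed.

(** Two mean values: first along [u] for the increment [psi] of [f] in direction [v], then along [v]
    for ['D_u f]. *)
Lemma second_difference (V : normedModType R) (f : V -> R) x u v r (s : R) :
  (forall y, ball x r y -> derivable f y u /\ derivable ('D_u f) y v) ->
  `|s| * (`|u| + `|v|) < r ->
  exists2 p, ball x r p &
    f (x + s *: u + s *: v) - f (x + s *: u) - (f (x + s *: v) - f x) =
    s * (s * 'D_v ('D_u f) p).
Proof.
move=> df sr.
have xr (a b : R) : `|a| <= `|s| -> `|b| <= `|s| -> ball x r (x + a *: u + b *: v).
  move=> ha hb; rewrite -ball_normE /= -addrA opprD addrA subrr add0r normrN.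
  apply: le_lt_trans sr; rewrite mulrDr.
  by apply: le_trans (ler_normD _ _) _; rewrite !normrZ lerD// ler_wpM2r.
pose psi y := f (y + s *: v) - f y.
have dpsi t : `|t| <= `|s| -> is_derive (x + t *: u) u psi
    ('D_u f (x + t *: u + s *: v) - 'D_u f (x + t *: u)).
  move=> ts; rewrite /psi.
  have [d1 _] := df _ (xr t s ts (lexx _)).
  have h0 : `|0 : R| <= `|s| by rewrite normr0.
  have [d2 _] := df _ (xr t 0 ts h0); rewrite scale0r addr0 in d2.
  apply: is_deriveB; last exact: derivableP.
  have E : (fun h : R => h^-1 *:
      (((fun y => f (y + s *: v)) \o shift (x + t *: u)) (h *: u) - f (x + t *: u + s *: v)))
     = (fun h => h^-1 *: ((f \o shift (x + t *: u + s *: v)) (h *: u) - f (x + t *: u + s *: v))).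
    by apply/funext => h /=; rewrite !addrA.
  by split; rewrite /derivable /derive E.
have [t ts|c cs Ec] := @MVT_line _ psi x u s; first by have [] := dpsi t ts.
have [t ts|d ds Ed] := @MVT_line _ ('D_u f) (x + c *: u) v s.
  by have [] := df _ (xr c t cs ts).
exists (x + c *: u + d *: v); first exact: xr.
by rewrite -Ed; have [_ <-] := dpsi c cs; rewrite -Ec.
Qed.

(** Schwarz's theorem. One second difference equals [s ^ 2] times either mixed derivative, taken at
    two points [p] and [q] near [x]; continuity at [x] then makes the mixed derivatives at [x]
    differ by at most any [e]. *)
Lemma derive_sym (V : normedModType R) (f : V -> R) x u v :
  (\forall y \near x, [/\ derivable f y u, derivable f y v,
     derivable ('D_u f) y v & derivable ('D_v f) y u]) ->
  {for x, continuous ('D_v ('D_u f))} ->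
  {for x, continuous ('D_u ('D_v f))} ->
  'D_v ('D_u f) x = 'D_u ('D_v f) x.
Proof.
move=> df cvu cuv; apply/eqP; rewrite -subr_eq0 -normr_le0; apply/ler_addgt0Pr => e e0.
rewrite add0r.
have e2 : 0 < e / 2 by rewrite divr_gt0.
have /cvgrPdist_lt/(_ _ e2) h1 := cvu.
have /cvgrPdist_lt/(_ _ e2) h2 := cuv.
have [r /= r0 hr] := (nbhs_ballP _ _).1 (filterI df (filterI h1 h2)).
(* The summand [1] keeps the denominator of [s] positive even when [u] and [v] both vanish. *)
have w0 : 0 < `|u| + `|v| + 1 by rewrite ltr_wpDl// addr_ge0.
pose s := r / (`|u| + `|v| + 1).
have s0 : 0 < s by rewrite divr_gt0.
have sr : `|s| * (`|u| + `|v|) < r.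
  by rewrite gtr0_norm// /s -mulrA gtr_pMr// mulrC ltr_pdivrMr// mul1r ltrDl.
have [y /hr[[? ? ? ?] _]|p /hr[_ [hp _]] Ep] := @second_difference _ f x u v r s _ sr.
  by split.
have [y /hr[[? ? ? ?] _]||q /hr[_ [_ hq]] Eq] := @second_difference _ f x v u r s; first by split.
  by rewrite [`|v| + _]addrC.
(* The second difference is symmetric in [u] and [v]; the two factors [s] are cancelled one after
   the other. *)
have pq : 'D_v ('D_u f) p = 'D_u ('D_v f) q.
  apply: (mulfI (lt0r_neq0 s0)); apply: (mulfI (lt0r_neq0 s0)).
  apply: etrans (esym Ep) (etrans _ Eq).
  by rewrite [x + s *: v + _]addrAC !opprB [LHS]addrACA [RHS]addrACA [- _ - _]addrC.
rewrite (splitr e); apply: ltW; apply: le_lt_trans (ltrD hp hq).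
by rewrite -pq [X in _ <= _ + X]distrC; apply: le_trans (ler_normD _ _); rewrite addrA subrK.
Qed.

End Calculus.

(** * Smooth functions: differentiability and derivatives along curves *)

Section Smooth.
Variable R : realType.

Lemma near_eq_continuous (S T : topologicalType) (f h : S -> T) x :
  (\near x, f x = h x) -> {for x, continuous f} -> {for x, continuous h}.
Proof.
move=> fh; rewrite /prop_for /continuous_at (nbhs_singleton fh) => fc.
by apply: cvg_trans fc; apply: near_eq_cvg; apply: filterS fh.
Qed.

Lemma smooth_onD n (V : normedModType R) A (f : 'rV[R]_n -> V) i :
  smooth_on A f -> smooth_on A ('D_(delta_mx 0 i) f).
Proof. by move=> sf k; have [_ /(_ i)[]] := sf k.+1. Qed.

Lemma smooth_on_continuous n (V : normedModType R) A (f : 'rV[R]_n -> V) x :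
  smooth_on A f -> A x -> {for x, continuous f}.
Proof. by move=> /(_ 0%N)[+ _]; apply. Qed.

Lemma smooth_on_derivable n (V : normedModType R) A (f : 'rV[R]_n -> V) x i :
  smooth_on A f -> A x -> derivable f x (delta_mx 0 i).
Proof. by move=> /(_ 1%N)[_ /(_ i)[+ _]]; apply. Qed.

(** Openness turns equality on [A] into equality near each of its points, which is what derivatives
    see; the induction can then pass to the partial derivatives. *)
Lemma Ck_on_ext n (V : normedModType R) k A (f h : 'rV[R]_n -> V) :
  open A -> {in A, f =1 h} -> Ck_on k A f -> Ck_on k A h.
Proof.
move=> oA; have nearE (f' h' : 'rV[R]_n -> V) x : {in A, f' =1 h'} -> A x -> \near x, f' x = h' x.
  move=> fh Ax; near=> y; apply: fh; rewrite inE; near: y; exact: open_nbhs_nbhs.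
elim: k f h => [|k IH] f h fh [fc fd]; split=> //.
- by move=> x Ax; apply: near_eq_continuous (nearE _ _ _ fh Ax) (fc x Ax).
- by move=> x Ax; apply: near_eq_continuous (nearE _ _ _ fh Ax) (fc x Ax).
- move=> i; have [fi ki] := fd i; split.
    by move=> x Ax; apply: near_eq_derivable (fi x Ax); exact: nearE.
  apply: IH ki => x; rewrite inE => Ax.
  by apply: near_eq_derive; exact: nearE.
Unshelve. all: by end_near. Qed.

Lemma Ck_on_linear n (V : normedModType R) k A (f h : 'rV[R]_n -> V) (a : R) :
  open A -> Ck_on k A f -> Ck_on k A h -> Ck_on k A (a *: f + h).
Proof.
move=> oA; elim: k f h => [|k IH] f h [fc fd] [hc hd]; split=> //.
- by move=> x Ax; apply: continuousD; [apply: continuousZl_tmp; exact: fc|exact: hc].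
- by move=> x Ax; apply: continuousD; [apply: continuousZl_tmp; exact: fc|exact: hc].
- move=> i; have [fi fk] := fd i; have [hi hk] := hd i; split.
    by move=> x Ax; apply: derivableD; [apply: derivableZ; exact: fi|exact: hi].
  apply: Ck_on_ext (IH _ _ fk hk) => // x; rewrite inE => Ax.
  by rewrite deriveD ?deriveZ//; [exact: fi|apply: derivableZ; exact: fi|exact: hi].
Qed.

Lemma Ck_on_cst0 n (V : normedModType R) k A : Ck_on k A (0 : 'rV[R]_n -> V).
Proof.
have c0 : forall x, A x -> {for x, continuous (0 : 'rV[R]_n -> V)}.
  by move=> x _; exact: cst_continuous.
elim: k => [|k IH]; split=> // i.
split=> [x _|]; first exact: derivable_cst.
have -> : 'D_(delta_mx 0 i) (0 : 'rV[R]_n -> V) = 0; last by [].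
by apply/funext => x; exact: derive_cst.
Qed.

Lemma Ck_on_coord n m k A (f : 'rV[R]_n -> 'rV[R]_m) j :
  open A -> Ck_on k A f -> Ck_on k A (fun x => f x 0 j).
Proof.
move=> oA; elim: k f => [|k IH] f [fc fd]; split=> //.
- move=> x Ax; apply: (@continuous_comp _ _ _ f (fun M : 'rV_m => M 0 j)); first exact: fc.
  exact: coord_continuous.
- move=> x Ax; apply: (@continuous_comp _ _ _ f (fun M : 'rV_m => M 0 j)); first exact: fc.
  exact: coord_continuous.
- move=> i; have [fi fk] := fd i; split.
    by move=> x Ax; have /derivable_mxP := fi x Ax.
  apply: Ck_on_ext (IH _ fk) => // x; rewrite inE => Ax.
  by rewrite derive_mx ?mxE//; exact: fi.
Qed.

Lemma smooth_on_coord n m A (f : 'rV[R]_n -> 'rV[R]_m) j :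
  open A -> smooth_on A f -> smooth_on A (fun x => f x 0 j).
Proof. by move=> oA sf k; apply: Ck_on_coord. Qed.

(* Continuous partial derivatives give differentiability: the increment is
   telescoped along the coordinate axes and each step is controlled by the mean
   value theorem. *)
Lemma smooth_on_differentiable1 n A (f : 'rV[R]_n -> R) x :
  open A -> smooth_on A f -> A x -> differentiable f x.
Proof.
move=> oA sf Ax.
pose e_ i : 'rV[R]_n := delta_mx 0 i.
(* [l] is the candidate differential; the rest shows that it is linear, continuous, and approximates
   [f] to first order. *)
pose l (h : 'rV[R]_n) := \sum_i h 0 i * 'D_(e_ i) f x.
have l_lin : linear l.
  move=> a u v; rewrite /l scaler_sumr -big_split/=; apply: eq_bigr => i _.
  by rewrite !mxE mulrDl /GRing.scale/= mulrA.
pose lM := GRing.isLinear.Build _ _ _ _ _ l_lin.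
pose lL : {linear 'rV[R]_n -> R} := HB.pack l lM.
have lc : continuous lL.
  have -> : (lL : 'rV[R]_n -> R) = \sum_i (fun h : 'rV[R]_n => h 0 i * 'D_(e_ i) f x).
    by apply/funext => h; rewrite fct_sumE.
  move=> h; apply: (big_ind (fun F : 'rV[R]_n -> R => {for h, continuous F})).
  - exact: cst_continuous.
  - by move=> F1 F2 c1 c2; exact: continuousD.
  - by move=> i _; apply: continuousM; [exact: coord_continuous|exact: cst_continuous].
have hO : forall e : R, 0 < e -> \forall h \near (0 : 'rV[R]_n),
    `|f (h + x) - f x - l h| <= e * `|h|.
  move=> e e0.
  have nA : \forall y \near x, A y by exact: open_nbhs_nbhs.
  (* Each of the [n] axis steps will cost at most this times the norm of [h]; the successor keeps
     the denominator nonzero when [n] is 0. *)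
  have en : 0 < e / n.+1%:R by rewrite divr_gt0.
  have cD : \forall y \near x, forall i : 'I_n, `|'D_(e_ i) f x - 'D_(e_ i) f y| < e / n.+1%:R.
    apply: (@filter_forall _ _ _ (nbhs x)) => i.
    by have /cvgrPdist_lt/(_ _ en) := smooth_on_continuous (smooth_onD i sf) Ax.
  have [r /= r0 hr] := (nbhs_ballP _ _).1 (filterI nA cD).
  near=> h.
  have hr' : `|h| < r.
    near: h; apply/nbhs_ballP; exists r => //= z; rewrite -ball_normE/= sub0r normrN//.
  (* The corners of the axis-parallel path from 0 to [h]: [p k] keeps the first [k] coordinates of
     [h]. *)
  pose p (k : nat) : 'rV[R]_n := \row_i (if (i < k)%N then h 0 i else 0).
  have p0 : p 0%N = 0 by apply/rowP => i; rewrite !mxE.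
  have pn : p n = h by apply/rowP => i; rewrite !mxE ltn_ord.
  have pS (i : 'I_n) : p i.+1 = p i + h 0 i *: e_ i.
    apply/rowP => j; rewrite !mxE eqxx/= ltnS leq_eqVlt.
    have [->|ji] := eqVneq j i; first by rewrite eqxx/= ltnn add0r mulr1.
    have /negPf-> : (j != i :> nat) by [].
    by rewrite mulr0 addr0.
  have hle i : `|h 0 i| <= `|h|.
    by rewrite [leRHS]/Num.Def.normr/= mx_normrE; apply: (le_bigmax _ _ (0, i)).
  (* The norm on rows is the sup norm, so no point of the path is farther from [x] than the norm of
     [h]. *)
  have inb (i : 'I_n) (t : R) : `|t| <= `|h 0 i| -> ball x r (x + p i + t *: e_ i).
    move=> ti; rewrite -ball_normE/= -addrA opprD addrA subrr add0r normrN.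
    apply: le_lt_trans hr'; rewrite [leLHS]/Num.Def.normr/= mx_normrE.
    apply: bigmax_le => // -[a j] _ /=; rewrite !mxE (ord1 a) eqxx/=.
    have [->|ji] := eqVneq j i; first by rewrite ltnn add0r mulr1; apply: le_trans ti _.
    by rewrite mulr0 addr0; case: ifP => // _; rewrite normr0.
  have step (i : 'I_n) : `|f (x + p i.+1) - f (x + p i) - h 0 i * 'D_(e_ i) f x|
      <= (e / n.+1%:R) * `|h|.
    have [t ts|c cs Ec] := @MVT_line _ _ f (x + p i) (e_ i) (h 0 i).
      by have [h1 _] := hr _ (inb i t ts); exact: smooth_on_derivable sf h1.
    rewrite pS addrA Ec -mulrBr normrM mulrC; apply: ler_pM => //.
    by rewrite distrC; apply: ltW; have [_] := hr _ (inb i c cs); apply.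
  have -> : f (h + x) - f x - l h =
     \sum_(i < n) (f (x + p i.+1) - f (x + p i) - h 0 i * 'D_(e_ i) f x).
    rewrite sumrB -/(l h) -(big_mkord xpredT (fun i => f (x + p i.+1) - f (x + p i))).
    by rewrite (@telescope_sumr _ _ _ (fun i => f (x + p i)))// pn p0 addr0 [h + x]addrC.
  apply: le_trans (ler_norm_sum _ _ _) _; apply: le_trans (ler_sum _ (fun i _ => step i)) _.
  rewrite sumr_const card_ord -[leLHS]mulr_natl mulrA ler_wpM2r//.
  by rewrite mulrCA ler_piMr ?ltW// ltr_pdivrMr// mul1r ltr_nat.
have rem : f \o shift x = cst (f x) + (lL : 'rV[R]_n -> R) +o_ (0 : 'rV[R]_n) id.
  apply/eqaddoP => e e0; near=> h => /=.
  rewrite [X in `|X| <= _](_ : _ = f (h + x) - f x - l h); last first.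
    by rewrite -[LHS]/(f (h + x) - (f x + l h)) opprD addrA.
  by near: h; exact: hO.
have dE : 'd f x = lL :> ('rV[R]_n -> R) by exact: diff_unique.
by apply/diff_locallyP; rewrite dE.
Unshelve. all: by end_near. Qed.

Lemma smooth_on_differentiable n m A (f : 'rV[R]_n -> 'rV[R]_m) x :
  open A -> smooth_on A f -> A x -> differentiable f x.
Proof.
move=> oA sf Ax.
have -> : f = \sum_(j < m) (fun y => f y 0 j *: (delta_mx 0 j : 'rV[R]_m)).
  by apply/funext => y; rewrite fct_sumE [LHS]row_sum_delta.
apply: differentiable_sum => j; apply: differentiableZl.
exact: smooth_on_differentiable1 (smooth_on_coord j oA sf) Ax.
Qed.

Lemma deriveEsum n (V : normedModType R) (f : 'rV[R]_n -> V) x v :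
  differentiable f x -> 'D_v f x = \sum_i v 0 i *: 'D_(delta_mx 0 i) f x.
Proof.
move=> df; rewrite deriveE// {1}(row_sum_delta v) linear_sum/=.
by apply: eq_bigr => i _; rewrite linearZ/= deriveE.
Qed.

(** [Ck_on] speaks of the coordinate directions only; on [A] the derivative along [v] is a constant
    combination of those partial derivatives. *)
Lemma smooth_on_derive n m A (f : 'rV[R]_n -> 'rV[R]_m) v :
  open A -> smooth_on A f -> smooth_on A ('D_v f).
Proof.
move=> oA sf k.
have : Ck_on k A (\sum_i v 0 i *: ('D_(delta_mx 0 i) f)).
  elim/big_rec: _ => [|i F _ CF]; first exact: Ck_on_cst0.
  by apply: Ck_on_linear => //; exact: smooth_onD.
apply: Ck_on_ext => // x; rewrite inE => Ax.
by rewrite fct_sumE (deriveEsum v (smooth_on_differentiable oA sf Ax)).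
Qed.

Lemma smooth_on_derive_sym n m A (f : 'rV[R]_n -> 'rV[R]_m) x u v :
  open A -> smooth_on A f -> A x -> 'D_v ('D_u f) x = 'D_u ('D_v f) x.
Proof.
move=> oA sf Ax; apply/rowP => j.
have dd (F : 'rV[R]_n -> 'rV[R]_m) w y : smooth_on A F -> A y -> derivable F y w.
  by move=> sF Ay; exact: diff_derivable (smooth_on_differentiable oA sF Ay).
have sD w : smooth_on A ('D_w f) by exact: smooth_on_derive.
have nA : \forall y \near x, A y by exact: open_nbhs_nbhs.
pose fj y := f y 0 j.
have E1 w y : A y -> 'D_w fj y = 'D_w f y 0 j.
  by move=> Ay; rewrite derive_mx ?mxE//; exact: dd.
have E2 w w' y : A y -> 'D_w ('D_w' fj) y = 'D_w ('D_w' f) y 0 j.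
  move=> Ay; rewrite derive_mx ?mxE; last exact: dd.
  apply: near_eq_derive; near=> z; apply: E1.
  by near: z; exact: open_nbhs_nbhs.
have c2 w w' : {for x, continuous ('D_w ('D_w' fj))}.
  have /(smooth_on_coord j oA) sww : smooth_on A ('D_w ('D_w' f)) by apply: smooth_on_derive.
  apply: near_eq_continuous (smooth_on_continuous sww Ax).
  by apply: filterS nA => y Ay; rewrite E2.
have d1 w y : A y -> derivable fj y w by move=> Ay; have /derivable_mxP/(_ 0 j) := dd _ w _ sf Ay.
have d2 w w' y : A y -> derivable ('D_w' fj) y w.
  move=> Ay; have /derivable_mxP/(_ 0 j) := dd _ w _ (sD w') Ay.
  apply: near_eq_derivable; near=> z; apply/esym/E1.
  by near: z; exact: open_nbhs_nbhs.
transitivity ('D_v ('D_u fj) x); first by rewrite E2.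
transitivity ('D_u ('D_v fj) x); last by rewrite E2.
apply: derive_sym; [|exact: c2|exact: c2].
apply: filterS nA => y Ay; split; [exact: d1|exact: d1|exact: d2|exact: d2].
Unshelve. all: by end_near. Qed.

Lemma derive_lin n (V : normedModType R) (f : 'rV[R]_n -> V) x a u v :
  differentiable f x -> 'D_(a *: u + v) f x = a *: 'D_u f x + 'D_v f x.
Proof. by move=> df; rewrite !deriveE// linearP. Qed.

(** Base point and direction both move. Expanding the direction over the axes turns the function
    into a sum of products of a coordinate of [w] with a partial derivative along [z]; the product
    rule gives the two terms. *)
Lemma is_derive_dir n m A (f : 'rV[R]_n -> 'rV[R]_m) (z w : R -> 'rV[R]_n)
  (t : R) y u z' w' :
  open A -> smooth_on A f -> A y -> z t = y -> w t = u ->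
  is_derive t (1 : R) z z' -> is_derive t (1 : R) w w' ->
  is_derive t (1 : R) (fun s => 'D_(w s) f (z s)) ('D_w' f y + 'D_z' ('D_u f) y).
Proof.
move=> oA sf Ay zy wu dz dw.
have df x : A x -> differentiable f x by exact: smooth_on_differentiable.
have nA : \forall x \near y, A x by exact: open_nbhs_nbhs.
have nz : \forall s \near t, A (z s).
  have zc : {for t, continuous z}.
    by apply/differentiable_continuous/derivable1_diffP; have [] := dz.
  by apply: zc; rewrite zy.
have dDi i : differentiable ('D_(delta_mx 0 i) f) y.
  exact: (smooth_on_differentiable oA (smooth_onD i sf) Ay).
have -> : 'D_w' f y + 'D_z' ('D_u f) y =
  \sum_i (w' 0 i *: 'D_(delta_mx 0 i) f (z t) + w t 0 i *: 'D_z' ('D_(delta_mx 0 i) f) y).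
  rewrite zy wu big_split/= -deriveEsum; last exact: df.
  congr (_ + _).
  rewrite (@near_eq_derive _ _ _ _ (\sum_i u 0 i *: 'D_(delta_mx 0 i) f)).
    rewrite derive_sum; last by move=> i; apply: derivableZ; exact: diff_derivable.
    by apply: eq_bigr => i _; rewrite deriveZ//; exact: diff_derivable.
  by apply: filterS nA => x Ax; rewrite fct_sumE deriveEsum//; exact: df.
apply: (@near_eq_is_derive _ _ _ (\sum_i (fun s => w s 0 i *: 'D_(delta_mx 0 i) f (z s)))).
  by apply: filterS nz => s As; rewrite fct_sumE [RHS]deriveEsum//; exact: df.
apply: is_derive_sum => i; apply: is_derive_scale; first exact: is_derive_mx_coord.
exact: is_derive_curve.
Qed.

(** With the base point fixed, the function is the continuous linear map ['d f y] applied to the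
    curve [w]. *)
Lemma is_derive_dirl n (V : normedModType R) (f : 'rV[R]_n -> V) (w : R -> 'rV[R]_n) (t : R) y w' :
  differentiable f y -> is_derive t (1 : R) w w' ->
  is_derive t (1 : R) (fun s => 'D_(w s) f y) ('D_w' f y).
Proof.
move=> df dw.
have dc : continuous ('d f y) by exact: diff_continuous.
have dd : differentiable ('d f y) (w t) by exact: linear_differentiable.
have [h1 h2] := is_derive_curve erefl dd dw.
have E : (fun s => 'D_(w s) f y) = (fun s => 'd f y (w s)).
  by apply/funext => s; exact: deriveE.
split; rewrite E//; apply: etrans h2 _; apply: etrans (deriveE _ dd) _.
by rewrite (diff_lin _ dc); apply/esym/deriveE.
Qed.

End Smooth.

(** * Charts and velocities of curves *)

Lemma continuous_at_pair (S T U : topologicalType) (f : S -> T) (h : S -> U) x :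
  {for x, continuous f} -> {for x, continuous h} ->
  {for x, continuous (fun y => (f y, h y))}.
Proof. by move=> cf ch; exact: cvg_pair. Qed.

Section Charts.
Variable R : realType.

Lemma continuous_at_row_mx (S : topologicalType) m n (f : S -> 'rV[R]_m)
    (h : S -> 'rV[R]_n) x :
  {for x, continuous f} -> {for x, continuous h} ->
  {for x, continuous (fun y => row_mx (f y) (h y))}.
Proof.
move=> cf ch; apply/cvg_ballP => e e0.
have /cvg_ballP/(_ _ e0) nf := cf; have /cvg_ballP/(_ _ e0) nh := ch.
near=> y; split=> // i j; rewrite !mxE; case: splitP => k _.
  by have [_] : ball (f x) e (f y) by near: y.
by have [_] : ball (h x) e (h y) by near: y.
Unshelve. all: by end_near. Qed.

Lemma is_derive_row_mx (V : normedModType R) m n (f : V -> 'rV[R]_m)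
    (h : V -> 'rV[R]_n) t v df dh :
  is_derive t v f df -> is_derive t v h dh ->
  is_derive t v (fun x => row_mx (f x) (h x)) (row_mx df dh).
Proof.
move=> Df Dh; apply: is_derive_mx => i j; rewrite mxE.
case: (splitP j) => k jk.
  have -> : (fun x => row_mx (f x) (h x) i j) = (fun x => f x i k).
    by apply/funext => x; rewrite (_ : j = lshift n k) ?row_mxEl//; exact: val_inj.
  exact: is_derive_mx_coord.
have -> : (fun x => row_mx (f x) (h x) i j) = (fun x => h x i k).
  by apply/funext => x; rewrite (_ : j = rshift m k) ?row_mxEr//; exact: val_inj.
exact: is_derive_mx_coord.
Qed.

(** Near a point of the image, continuity of [cinv c] brings nearby coordinates back into [U], and
    openness of [cim c] makes them coordinates of actual points of the chart. *)
Lemma chart_image_open (T : topologicalType) n (c : chart R T n) (U : set T) :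
  is_chart c -> open U -> open (cmap c @` (cdom c `&` U)).
Proof.
move=> hc oU; rewrite openE => _ [x [cx Ux] <-].
have cy : cim c (cmap c x) by exists x.
have nc : \forall y \near cmap c x, cim c y.
  by apply: open_nbhs_nbhs; split=> //; exact: chart_im_open.
have nU : \forall y \near cmap c x, U (cinv c y).
  apply: (chart_inv_cont hc cy); apply: open_nbhs_nbhs; split=> //.
  by rewrite (chart_mapK hc).
apply: filterS (filterI nc nU) => _ [[z cz <-]]; rewrite (chart_mapK hc)// => Uz.
by exists z.
Qed.

Lemma prod_is_chart (S T : topologicalType) m n (c : chart R S m) (d : chart R T n) :
  is_chart c -> is_chart d -> is_chart (prod_chart c d).
Proof.
move=> hc hd.
have cimE : cim (prod_chart c d) = (fun y => cim c (lsubmx y)) `&` (fun y => cim d (rsubmx y)).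
  apply/seteqP; split=> [_ [[a b] [/= ca db] <-]|y [[a ca ea] [b db eb]]].
    by split; rewrite /= (row_mxKl, row_mxKr); [exists a|exists b].
  by exists (a, b) => //=; rewrite ea eb hsubmxK.
split.
- rewrite openE => -[a b] [/= ca db]; exists (cdom c, cdom d) => //; split=> /=.
    by apply: open_nbhs_nbhs; split=> //; exact: chart_dom_open.
  by apply: open_nbhs_nbhs; split=> //; exact: chart_dom_open.
- rewrite cimE; apply: openI.
    apply: open_comp (chart_im_open hc) => y _; exact: continuous_lsubmx.
  apply: open_comp (chart_im_open hd) => y _; exact: continuous_rsubmx.
- by move=> [a b] [/= ca db]; rewrite row_mxKl row_mxKr !chart_mapK.
- move=> [a b] [/= ca db]; apply: continuous_at_row_mx.
    apply: (@continuous_comp _ _ _ fst (cmap c)); first exact: cvg_fst.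
    exact: chart_map_cont.
  apply: (@continuous_comp _ _ _ snd (cmap d)); first exact: cvg_snd.
  exact: chart_map_cont.
- rewrite cimE => y [/= cy dy]; apply: continuous_at_pair.
    apply: (@continuous_comp _ _ _ lsubmx (cinv c)); first exact: continuous_lsubmx.
    exact: chart_inv_cont.
  apply: (@continuous_comp _ _ _ rsubmx (cinv d)); first exact: continuous_rsubmx.
  exact: chart_inv_cont.
Qed.

(* [lexp c d F] is meaningful only on [ldom c d F]. *)
Definition lexp (S T : Type) m n (c : chart R S m) (d : chart R T n) (F : S -> T) :=
  cmap d \o F \o cinv c.

Definition ldom (S T : Type) m n (c : chart R S m) (d : chart R T n) (F : S -> T) :=
  cmap c @` (cdom c `&` F @^-1` cdom d).

Lemma ldom_open (S T : topologicalType) m n (c : chart R S m) (d : chart R T n) F :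
  is_chart c -> is_chart d -> continuous F -> open (ldom c d F).
Proof.
move=> hc hd cF; apply: chart_image_open => //.
by apply: open_comp (chart_dom_open hd) => x _; exact: cF.
Qed.

(** Continuity of the curve is part of the definition: [cmap c] is arbitrary outside [cdom c], so
    derivability of the coordinates alone would not keep the curve in the chart. *)
Definition has_velocity (T : topologicalType) n (c : chart R T n) (a : R -> T)
    (v : 'rV[R]_n) : Prop :=
  [/\ {for (0 : R), continuous a}, cdom c (a 0)
    & is_derive (0 : R) (1 : R) (cmap c \o a) v].

(** This is how identities between tangent vectors are obtained below: the velocity of one curve is
    computed in two ways. *)
Lemma has_velocity_unique (T : topologicalType) n (c : chart R T n) a v w :
  has_velocity c a v -> has_velocity c a w -> v = w.
Proof. by move=> [_ _ [_ <-]] [_ _ [_ <-]]. Qed.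

Lemma has_velocity_cst (T : topologicalType) n (c : chart R T n) x :
  cdom c x -> has_velocity c (fun=> x) 0.
Proof.
move=> cx; split=> //; first exact: cst_continuous.
exact: is_derive_cst.
Qed.

Lemma near_dom (T : topologicalType) n (c : chart R T n) (a : R -> T) :
  is_chart c -> {for (0 : R), continuous a} -> cdom c (a 0) ->
  \forall t \near (0 : R), cdom c (a t).
Proof.
by move=> hc ca c0; apply: ca; apply: open_nbhs_nbhs; split=> //; exact: chart_dom_open.
Qed.

(** Chain rule; the curve stays in [cdom c] for small times, where [cinv c] undoes [cmap c]. *)
Lemma has_velocity_comp (S T : topologicalType) m n (c : chart R S m) (d : chart R T n)
    (F : S -> T) a v :
  is_chart c -> is_chart d -> {for a 0, continuous F} ->
  differentiable (lexp c d F) (cmap c (a 0)) ->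
  has_velocity c a v -> cdom d (F (a 0)) ->
  has_velocity d (F \o a) ('D_v (lexp c d F) (cmap c (a 0))).
Proof.
move=> hc hd cF dF [ca c0 da] d0; split=> //.
  exact: continuous_comp.
apply: near_eq_is_derive (is_derive_curve erefl dF da).
apply: filterS (near_dom hc ca c0) => t ct /=.
by rewrite /lexp /= (chart_mapK hc).
Qed.

Lemma has_velocity_smooth (S T : topologicalType) m n (c : chart R S m) (d : chart R T n)
    (F : S -> T) a v :
  is_chart c -> is_chart d -> continuous F -> smooth_on (ldom c d F) (lexp c d F) ->
  has_velocity c a v -> cdom d (F (a 0)) ->
  has_velocity d (F \o a) ('D_v (lexp c d F) (cmap c (a 0))).
Proof.
move=> hc hd cF sF hv d0; apply: has_velocity_comp => //; first exact: cF.
apply: (smooth_on_differentiable (ldom_open hc hd cF) sF).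
by exists (a 0) => //; split=> //; have [] := hv.
Qed.

Lemma has_velocity_pair (S T : topologicalType) m n (c : chart R S m) (d : chart R T n)
    a b v w :
  has_velocity c a v -> has_velocity d b w ->
  has_velocity (prod_chart c d) (fun t => (a t, b t)) (row_mx v w).
Proof.
move=> [ca c0 da] [cb d0 db]; split=> //; first exact: continuous_at_pair.
exact: is_derive_row_mx.
Qed.

End Charts.

(** * The action and its fundamental fields *)

Lemma derive_row_mxr (R : realType) (V : normedModType R) m n
    (f : 'rV[R]_(m + n) -> V) u x v :
  'D_v (fun y => f (row_mx u y)) x = 'D_(row_mx 0 v) f (row_mx u x).
Proof.
have E : (fun h : R => h^-1 *: (((fun y => f (row_mx u y)) \o shift x) (h *: v) - f (row_mx u x)))
    = (fun h => h^-1 *: ((f \o shift (row_mx u x)) (h *: row_mx 0 v) - f (row_mx u x))).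
  by apply/funext => h /=; rewrite scale_row_mx add_row_mx scaler0 add0r.
by rewrite /derive E.
Qed.

Lemma is_derive_inner (R : realType) n (A : 'M[R]_n) (u v : R -> 'rV[R]_n) (t : R) du dv :
  is_derive t (1 : R) u du -> is_derive t (1 : R) v dv ->
  is_derive t (1 : R) (fun s => (u s *m A *m (v s)^T) 0 0)
    ((du *m A *m (v t)^T) 0 0 + (u t *m A *m dv^T) 0 0).
Proof.
move=> Du Dv.
have E (x y : 'rV[R]_n) : (x *m A *m y^T) 0 0 = \sum_j (\sum_i x 0 i * A i j) * y 0 j.
  by rewrite !mxE; apply: eq_bigr => j _; rewrite !mxE.
have -> : (fun s => (u s *m A *m (v s)^T) 0 0) =
    \sum_j ((\sum_i ((fun s => u s 0 i) * cst (A i j))) * (fun s => v s 0 j)).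
  by apply/funext => s; rewrite E fct_sumE; apply: eq_bigr => j _; rewrite !fctE fct_sumE.
rewrite !E -big_split/=; apply: is_derive_eq.
  apply: is_derive_sum => j; apply: is_deriveM (is_derive_mx_coord 0 j Dv).
  apply: is_derive_sum => i.
  exact: is_deriveM (is_derive_mx_coord 0 i Du) (is_derive_cst _ _ _).
apply: eq_bigr => j _; rewrite /GRing.scale/= addrC fct_sumE; congr (_ + _).
  rewrite mulrC; congr (_ * _); apply: eq_bigr => i _.
  by rewrite mulr0 add0r mulrC.
Qed.

Section LieAction.
Context (R : realType) (m : nat) (G : topGroupType) (cG : G -> chart R G m)
  (e : 'rV[R]_m -> G) (n : nat) (M : topologicalType) (cM : M -> chart R M n)
  (g : M -> 'M[R]_n) (act : G -> M -> M).
Hypotheses (HG : is_lie_group cG) (He : is_lie_exp cG e) (HM : is_manifold cM)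
  (Hact : is_smooth_action cG cM act) (Hiso : isometric_action cM g act).

Local Notation c1 := (cG 1%g).
Local Notation u0 := (cmap c1 1%g).
Local Notation tau := (fundamental_field e cM act).
Local Notation mulG := (fun p : G * G => (p.1 * p.2)%g).
Local Notation actG := (fun p : G * M => act p.1 p.2).
Local Notation mu := (lexp (prod_chart c1 c1) c1 mulG).
Local Notation Phi p := (lexp (prod_chart c1 (cM p)) (cM p) actG).
Local Notation x0 p := (cmap (cM p) p).

Let hG a : is_chart (cG a). Proof. exact: manifold_chart (lie_group_manifold HG) a. Qed.
Let hM p : is_chart (cM p). Proof. exact: manifold_chart HM p. Qed.
Let c1_1 : cdom c1 1%g. Proof. exact: manifold_center (lie_group_manifold HG) _. Qed.
Let cMp p : cdom (cM p) p. Proof. exact: manifold_center HM _. Qed.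

Let mu_open : open (ldom (prod_chart c1 c1) c1 mulG).
Proof.
by apply: ldom_open => //; [exact: prod_is_chart|have [] := lie_group_mul HG].
Qed.

Let mu_smooth : smooth_on (ldom (prod_chart c1 c1) c1 mulG) mu.
Proof. by have [_ /(_ (1%g, 1%g) 1%g)] := lie_group_mul HG. Qed.

Let Phi_open p : open (ldom (prod_chart c1 (cM p)) (cM p) actG).
Proof.
by apply: ldom_open => //; [exact: prod_is_chart|have [] := action_smooth Hact].
Qed.

Let Phi_smooth p : smooth_on (ldom (prod_chart c1 (cM p)) (cM p) actG) (Phi p).
Proof. by have [_ /(_ (1%g, p) p)] := action_smooth Hact. Qed.

Lemma mul_velocity a b v w :
  has_velocity c1 a v -> has_velocity c1 b w -> cdom c1 (a 0 * b 0)%g ->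
  has_velocity c1 (fun t => (a t * b t)%g)
    ('D_(row_mx v w) mu (row_mx (cmap c1 (a 0)) (cmap c1 (b 0)))).
Proof.
move=> ha hb ab; have hab := has_velocity_pair ha hb.
apply: (has_velocity_smooth _ _ _ mu_smooth hab) => //; first exact: prod_is_chart.
by have [] := lie_group_mul HG.
Qed.

Lemma act_velocity p a b v w :
  has_velocity c1 a v -> has_velocity (cM p) b w -> cdom (cM p) (act (a 0) (b 0)) ->
  has_velocity (cM p) (fun t => act (a t) (b t))
    ('D_(row_mx v w) (Phi p) (row_mx (cmap c1 (a 0)) (cmap (cM p) (b 0)))).
Proof.
move=> ha hb ab; have hab := has_velocity_pair ha hb.
apply: (has_velocity_smooth _ _ _ (@Phi_smooth p) hab) => //; first exact: prod_is_chart.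
by have [] := action_smooth Hact.
Qed.

(** The one-parameter law at [0 + 0] makes this element idempotent, and the unit is the only
    idempotent of a group. *)
Lemma exp_scale0 U : e (0 *: U) = 1%g.
Proof.
have [eD _ _] := He U; have := eD 0 0; rewrite addr0.
move=> /(congr1 (fun a => (a * (e (0 *: U))^-1)%g)).
by rewrite mulgK mulgV => <-.
Qed.

Lemma exp_scaleN U (t : R) : (e (t *: U) * e (- t *: U))%g = 1%g.
Proof. by have [eD _ _] := He U; rewrite -eD subrr exp_scale0. Qed.

Lemma exp_continuous U : continuous (fun t : R => e (t *: U)).
Proof. by have [] := He U. Qed.

Lemma exp_velocity U : has_velocity c1 (fun t => e (t *: U)) U.
Proof.
have [_ ec dE] := He U; split=> //; first exact: ec.
by rewrite exp_scale0.
Qed.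

Lemma expN_velocity U : has_velocity c1 (fun t => e (- t *: U)) (- U).
Proof.
have -> : (fun t => e (- t *: U)) = (fun t => e (t *: - U)).
  by apply/funext => t; rewrite scaleNr scalerN.
exact: exp_velocity.
Qed.

(** The differential at the unit of the orbit map of [p], in the charts at the unit and at [p]. *)
Definition tang p (W : 'rV[R]_m) : 'rV[R]_n := 'D_(row_mx W 0) (Phi p) (row_mx u0 (x0 p)).

Let Phi_dom p a q : cdom c1 a -> cdom (cM p) q -> cdom (cM p) (act a q) ->
  ldom (prod_chart c1 (cM p)) (cM p) actG (row_mx (cmap c1 a) (cmap (cM p) q)).
Proof. by move=> ca cq caq; exists (a, q). Qed.

Let Phi_dom1 p q : cdom (cM p) q ->
  ldom (prod_chart c1 (cM p)) (cM p) actG (row_mx u0 (cmap (cM p) q)).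
Proof. by move=> cq; apply: Phi_dom; rewrite ?(action1 Hact). Qed.

Let Phi_diff1 p q : cdom (cM p) q -> differentiable (Phi p) (row_mx u0 (cmap (cM p) q)).
Proof.
by move=> cq; apply: (smooth_on_differentiable (@Phi_open p) (@Phi_smooth p)); exact: Phi_dom1.
Qed.

Lemma tang_linear p a V W : tang p (a *: V + W) = a *: tang p V + tang p W.
Proof.
rewrite /tang -derive_lin; last exact: Phi_diff1.
by rewrite scale_row_mx add_row_mx scaler0 addr0.
Qed.

Lemma orbit_velocity p q a W : cdom (cM p) q -> has_velocity c1 a W -> a 0 = 1%g ->
  has_velocity (cM p) (fun t => act (a t) q)
    ('D_(row_mx W 0) (Phi p) (row_mx u0 (cmap (cM p) q))).
Proof.
move=> cq ha a0; have := act_velocity ha (has_velocity_cst cq).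
by rewrite a0 (action1 Hact); apply.
Qed.

(** Replaces the derivative along an exponential curve by a differential, from which linearity in
    [U] can be read off. *)
Lemma fundamental_fieldE U p : tau U p = tang p U.
Proof.
by have [_ _ []] := orbit_velocity (cMp p) (exp_velocity U) (exp_scale0 U).
Qed.

Lemma fundamental_field_linear a V W : tau (a *: V + W) = a *: tau V + tau W.
Proof. by apply/funext => p; rewrite !fctE !fundamental_fieldE tang_linear. Qed.

(** The orbit of [q] under [exp (tV)] has a velocity read directly in the chart at [p], and another
    one carried there from the chart at [q] by the transition map; the two agree. *)
Lemma vlocal_fundamental p q V : cdom (cM p) q ->
  vlocal cM p (tau V) (cmap (cM p) q) =
  'D_(row_mx V 0) (Phi p) (row_mx u0 (cmap (cM p) q)).
Proof.
move=> cq; rewrite /vlocal (chart_mapK (hM p))// fundamental_fieldE.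
have h1 := orbit_velocity (cMp q) (exp_velocity V) (exp_scale0 V).
have h2 := orbit_velocity cq (exp_velocity V) (exp_scale0 V).
have q0 : act (e (0 *: V)) q = q by rewrite exp_scale0 (action1 Hact).
have sT := manifold_transition HM q p.
have := @has_velocity_smooth _ _ _ _ _ (cM q) (cM p) idfun _ _ (hM q) (hM p)
   (fun x => cvg_id) sT h1.
by rewrite /= q0 => /(_ cq) /has_velocity_unique /(_ h2).
Qed.

(** * The adjoint representation along a one-parameter subgroup *)

Section Adjoint.
Variable U : 'rV[R]_m.
Local Notation gam t := (cmap c1 (e (t *: U))).

(* The coordinate expression of Ad (exp (t U)) V. *)
Definition Ad (t : R) (V : 'rV[R]_m) : 'rV[R]_m :=
  'D_(row_mx ('D_(row_mx 0 V) mu (row_mx (gam t) u0)) 0) mu (row_mx (gam t) (gam (- t))).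

Definition ad (V : 'rV[R]_m) : 'rV[R]_m := 'D_(1 : R) (fun t : R => Ad t V) 0.

Lemma near_c1 : \forall t \near (0 : R), cdom c1 (e (t *: U)).
Proof. by apply: near_dom; [exact: hG|exact: exp_continuous|rewrite exp_scale0]. Qed.

Lemma near_c1N : \forall t \near (0 : R), cdom c1 (e (- t *: U)).
Proof.
by have [ce d0 _] := expN_velocity U; apply: near_dom => //; exact: hG.
Qed.

(** Justifies the formula for [Ad]: the product rule is applied to the left factor and then to the
    right one. Both exponentials must lie in the chart at the unit, which holds for small [t]. *)
Lemma conj_velocity t V : cdom c1 (e (t *: U)) -> cdom c1 (e (- t *: U)) ->
  has_velocity c1 (fun s => (e (t *: U) * e (s *: V) * e (- t *: U))%g) (Ad t V).
Proof.
move=> ct cNt.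
have h1 := mul_velocity (has_velocity_cst ct) (exp_velocity V).
rewrite exp_scale0 mulg1 in h1; have {}h1 := h1 ct.
have := mul_velocity h1 (has_velocity_cst cNt).
by rewrite exp_scale0 mulg1 exp_scaleN; apply.
Qed.

Let mu_dom a b : cdom c1 a -> cdom c1 b -> cdom c1 (a * b)%g ->
  ldom (prod_chart c1 c1) c1 mulG (row_mx (cmap c1 a) (cmap c1 b)).
Proof. by move=> ca cb cab; exists (a, b). Qed.

Lemma Ad0 V : Ad 0 V = V.
Proof.
have c0 : cdom c1 (e (0 *: U)) by rewrite exp_scale0.
have := conj_velocity V c0; rewrite oppr0 => /(_ c0).
under [X in has_velocity _ X]eq_fun do rewrite exp_scale0 mul1g mulg1.
by move/has_velocity_unique; apply; exact: exp_velocity.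
Qed.

(** Only existence has to be shown, the value being [ad V] by definition. The inner derivative of
    [mu] is smooth along the curve, and the outer one is handled by [is_derive_dir]. *)
Lemma is_derive_Ad V : is_derive (0 : R) (1 : R) (fun t : R => Ad t V) (ad V).
Proof.
have [_ _ dg] := exp_velocity U; have [_ _ dgN] := expN_velocity U.
have D1 : ldom (prod_chart c1 c1) c1 mulG (row_mx u0 u0) by apply: mu_dom; rewrite ?mulg1.
have g0 : row_mx (gam 0) u0 = row_mx u0 u0 by rewrite exp_scale0.
have gN : row_mx (gam 0) (gam (- 0)) = row_mx u0 u0 by rewrite oppr0 exp_scale0.
have dz1 := is_derive_row_mx dg (is_derive_cst u0 (0 : R) (1 : R)).
have dz2 := is_derive_row_mx dg dgN.
have [dw _] := is_derive_curve g0
  (smooth_on_differentiable mu_open (smooth_on_derive (row_mx 0 V) mu_open mu_smooth) D1) dz1.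
have dw0 := is_derive_row_mx (derivableP dw) (is_derive_cst (0 : 'rV[R]_m) (0 : R) (1 : R)).
have [dA _] := is_derive_dir mu_open mu_smooth D1 gN erefl dz2 dw0.
exact: derivableP.
Qed.

Lemma near_Ad_linear a V W : \forall t \near (0 : R), Ad t (a *: V + W) = a *: Ad t V + Ad t W.
Proof.
apply: filterS (filterI near_c1 near_c1N) => t [ct cNt].
rewrite /Ad -derive_lin; last first.
  apply: (smooth_on_differentiable mu_open mu_smooth); apply: mu_dom => //.
  by rewrite exp_scaleN.
congr ('D_ _ _ _).
rewrite scale_row_mx add_row_mx scaler0 addr0 -derive_lin; last first.
  by apply: (smooth_on_differentiable mu_open mu_smooth); apply: mu_dom => //; rewrite mulg1.
by rewrite scale_row_mx add_row_mx scaler0 addr0.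
Qed.

Lemma ad_linear a V W : ad (a *: V + W) = a *: ad V + ad W.
Proof.
have [_ <-] := near_eq_is_derive
  (filterS (fun t => @esym _ _ _) (near_Ad_linear a V W))
  (is_deriveD (is_deriveZ a (is_derive_Ad V)) (is_derive_Ad W)).
by [].
Qed.

End Adjoint.

(** * Equivariance of fundamental fields, their brackets, and the metric *)

Let near_dom_act U p : \forall t \near (0 : R), cdom (cM p) (act (e (t *: U)) p).
Proof.
have [cb b0 _] := orbit_velocity (cMp p) (exp_velocity U) (exp_scale0 U).
exact: near_dom.
Qed.

(** Both sides are the velocity at [s = 0] of [exp (tU) exp (sV) p], which is also the conjugate of
    [exp (sV)] by [exp (tU)] acting on [exp (tU) p]. *)
Lemma near_equivariance U V p : \forall t \near (0 : R),
  'D_(row_mx 0 (tau V p)) (Phi p) (row_mx (cmap c1 (e (t *: U))) (x0 p)) =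
  'D_(row_mx (Ad U t V) 0) (Phi p)
     (row_mx u0 (cmap (cM p) (act (e (t *: U)) p))).
Proof.
apply: filterS (filterI (near_dom_act U p) (filterI (near_c1 U) (near_c1N U))).
move=> t [cp [ct cNt]].
have h1 := orbit_velocity (cMp p) (exp_velocity V) (exp_scale0 V).
have := act_velocity (has_velocity_cst ct) h1.
rewrite exp_scale0 (action1 Hact) => /(_ cp) hl.
have := orbit_velocity cp (conj_velocity V ct cNt).
rewrite exp_scale0 mulg1 exp_scaleN => /(_ erefl).
have -> : (fun s => act (e (t *: U) * e (s *: V) * e (- t *: U))%g (act (e (t *: U)) p)) =
    (fun s => act (e (t *: U)) (act (e (s *: V)) p)).
  apply/funext => s; rewrite -!(actionM Hact); congr act.
  by rewrite -[t in X in (_ * X)%g]opprK -mulgA exp_scaleN mulg1.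
move=> hr; rewrite fundamental_fieldE; exact: has_velocity_unique hl hr.
Qed.

Lemma vlocal_fundamental_derive p V w :
  'D_w (vlocal cM p (tau V)) (x0 p) =
  'D_(row_mx 0 w) ('D_(row_mx V 0) (Phi p)) (row_mx u0 (x0 p)).
Proof.
rewrite -derive_row_mxr; apply: near_eq_derive.
have nc : \forall y \near x0 p, cim (cM p) y.
  by apply: open_nbhs_nbhs; split; [exact: chart_im_open|exists p].
by apply: filterS nc => _ [q cq <-]; exact: vlocal_fundamental.
Qed.

(** Differentiate [near_equivariance] at [t = 0]. The left side gives one mixed derivative of [Phi];
    the right side gives the other one plus [tau (ad U V)]. The bracket is the difference of these
    mixed derivatives. *)
Lemma vbracket_fundamental U V : vbracket cM (tau U) (tau V) = - tau (ad U V).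
Proof.
apply/funext => p.
have Eb := congr2 (fun a b => a - b)
  (vlocal_fundamental_derive p V (tau U p)) (vlocal_fundamental_derive p U (tau V p)).
apply: etrans Eb _.
have D0 := Phi_dom1 (cMp p).
have [_ _ dg] := exp_velocity U.
have db : is_derive (0 : R) (1 : R) (cmap (cM p) \o (fun t => act (e (t *: U)) p)) (tau U p).
  by rewrite fundamental_fieldE; have [] := orbit_velocity (cMp p) (exp_velocity U) (exp_scale0 U).
have dl := is_derive_row_mx dg (is_derive_cst (x0 p) (0 : R) (1 : R)).
have dr := is_derive_row_mx (is_derive_cst u0 (0 : R) (1 : R)) db.
have dw := is_derive_row_mx (is_derive_Ad U V) (is_derive_cst (0 : 'rV[R]_n) (0 : R) (1 : R)).
have zl : row_mx (cmap c1 (e (0 *: U))) (x0 p) = row_mx u0 (x0 p) by rewrite exp_scale0.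
have zr : row_mx u0 (cmap (cM p) (act (e (0 *: U)) p)) = row_mx u0 (x0 p).
  by rewrite exp_scale0 (action1 Hact).
have w0 : row_mx (Ad U 0 V) 0 = row_mx V 0 :> 'rV[R]_(m + n) by rewrite Ad0.
have [_ El] := is_derive_curve zl (smooth_on_differentiable (@Phi_open p)
  (smooth_on_derive (row_mx 0 (tau V p)) (@Phi_open p) (@Phi_smooth p)) D0) dl.
have [_ Er] := is_derive_dir (@Phi_open p) (@Phi_smooth p) D0 zr w0 dr dw.
have En := near_eq_derive (1 : R) (near_equivariance U V p).
(* Exchanging the order of derivation gives the left side the shape in which the bracket contains
   it. *)
have Es := smooth_on_derive_sym (row_mx 0 (tau V p)) (row_mx U 0) (@Phi_open p) (@Phi_smooth p) D0.
have {Es} Es := etrans (esym Es) (etrans (esym El) (etrans En Er)).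
have {Es} Es : 'D_(row_mx 0 (tau V p)) ('D_(row_mx U 0) (Phi p)) (row_mx u0 (x0 p)) =
  tau (ad U V) p + 'D_(row_mx 0 (tau U p)) ('D_(row_mx V 0) (Phi p)) (row_mx u0 (x0 p)).
  by rewrite (fundamental_fieldE (ad U V)); exact: Es.
apply: etrans (congr1 (fun b => _ - b) Es) _.
by rewrite opprD addrCA subrr addr0.
Qed.

(** The two velocities of [near_equivariance] again, now read in the chart at the image point, where
    [dmap] and [tau] take their values. *)
Lemma dmap_fundamental U V t x : cdom c1 (e (t *: U)) -> cdom c1 (e (- t *: U)) ->
  dmap cM cM (act (e (t *: U))) x (tau V x) = tau (Ad U t V) (act (e (t *: U)) x).
Proof.
set a := e (t *: U) => ct cNt.
have h1 : has_velocity (cM x) (fun s => act (e (s *: V)) x) (tau V x).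
  rewrite fundamental_fieldE.
  exact: orbit_velocity (cMp x) (exp_velocity V) (exp_scale0 V).
have ca : cdom (cG a) a by exact: manifold_center (lie_group_manifold HG) _.
have hab := has_velocity_pair (has_velocity_cst ca) h1.
have [cA /(_ (a, x) (act a x)) sA] := action_smooth Hact.
have := has_velocity_smooth (prod_is_chart (hG a) (hM x)) (hM (act a x)) cA sA hab.
rewrite exp_scale0 /= (action1 Hact) => /(_ (cMp _)) hl.
have := orbit_velocity (cMp (act a x)) (conj_velocity V ct cNt).
rewrite exp_scale0 mulg1 exp_scaleN => /(_ erefl).
have -> : (fun s => act (e (t *: U) * e (s *: V) * e (- t *: U))%g (act (e (t *: U)) x)) =
    (fun s => act (e (t *: U)) (act (e (s *: V)) x)).
  apply/funext => s; rewrite -!(actionM Hact); congr act.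
  by rewrite -[t in X in (_ * X)%g]opprK -mulgA exp_scaleN mulg1.
move=> hr; rewrite (fundamental_fieldE (Ad U t V)).
apply: etrans (has_velocity_unique hl hr); apply: etrans (derive_row_mxr _ _ _ _).
(* The map [act a] is the action with its group variable frozen at [a], so its differential is the
   derivative in the second block. *)
have Ef : cmap (cM (act a x)) \o act a \o cinv (cM x) = (fun y =>
    lexp (prod_chart (cG a) (cM x)) (cM (act a x)) actG (row_mx (cmap (cG a) a) y)).
  by apply/funext => y; rewrite /lexp /= row_mxKl row_mxKr (chart_mapK (hG a)).
by rewrite /dmap Ef.
Qed.

(* A Killing field acts as a derivation of the metric: if g(V,W) is constant,
   differentiate t |-> g_x(Ad(exp tU) V, Ad(exp tU) W), which is constant too. *)
Lemma inner_fundamental_cst U V W r :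
  (forall y, inner g y (tau V y) (tau W y) = r) ->
  forall x, inner g x (tau (ad U V) x) (tau W x) + inner g x (tau V x) (tau (ad U W) x) = 0.
Proof.
move=> gr x.
have dtau Z : is_derive (0 : R) (1 : R) (fun t => tau (Ad U t Z) x) (tau (ad U Z) x).
  have -> : (fun t => tau (Ad U t Z) x) = (fun t => tang x (Ad U t Z)).
    by apply/funext => t; rewrite fundamental_fieldE.
  rewrite (fundamental_fieldE (ad U Z)).
  have dw := is_derive_row_mx (is_derive_Ad U Z) (is_derive_cst (0 : 'rV[R]_n) (0 : R) (1 : R)).
  exact: is_derive_dirl (Phi_diff1 (cMp x)) dw.
have [_ E] := is_derive_inner (g x) (dtau V) (dtau W).
rewrite !Ad0 in E; apply: etrans (esym E) _.
rewrite (@near_eq_derive _ _ _ _ (cst r)); first exact: derive_cst.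
apply: filterS (filterI (near_c1 U) (near_c1N U)) => t [ct cNt].
(* The isometry [exp (tU)] carries [y] to [x], so the value at [x] equals the product of [tau V] and
   [tau W] at [y], which is [r]. *)
pose y := act (e (- t *: U)) x.
have xy : act (e (t *: U)) y = x by rewrite -(actionM Hact) exp_scaleN (action1 Hact).
have := Hiso (e (t *: U)) y (tau V y) (tau W y).
by rewrite (dmap_fundamental V y ct cNt) (dmap_fundamental W y ct cNt) xy gr.
Qed.

End LieAction.

(** * Linear algebra of a field of constant length *)

Section Fitting.
Variables (R : realType) (E : lmodType R) (m : nat).
Variables (tau : 'rV[R]_m -> E) (D : 'rV[R]_m -> 'rV[R]_m) (L : E -> E).
Hypothesis tau_lin : forall a u v, tau (a *: u + v) = a *: tau u + tau v.
Hypothesis D_lin : forall a u v, D (a *: u + v) = a *: D u + D v.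
Hypothesis LE : forall v, L (tau v) = tau (D v).

(** The ranks of the powers decrease, so they are eventually constant; the opposite inclusion of row
    spaces being automatic, equal ranks suffice. The bound [2 <= k] puts the image of the power
    inside that of the square. *)
Lemma rank_power_stable (A : 'M[R]_m) :
  exists2 k, (2 <= k)%N & (A ^+ k <= A ^+ (k + k))%MS.
Proof.
have rank_le i j : (i <= j)%N -> (\rank (A ^+ j) <= \rank (A ^+ i))%N.
  by move=> /subnK <-; rewrite exprD; exact: mxrankM_maxr.
suff [k k2 kE] : exists2 k, (2 <= k)%N &
    forall j, (k <= j)%N -> (\rank (A ^+ k) <= \rank (A ^+ j))%N.
  exists k => //; rewrite -(geq_leqif (mxrank_leqif_sup _)); first by apply: kE; exact: leq_addr.
  by rewrite exprD; exact: submxMl.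
(* Induction on a bound for the rank: if a later power has smaller rank, start again from that
   power. *)
suff H r : forall k, (2 <= k)%N -> (\rank (A ^+ k) <= r)%N -> exists2 k, (2 <= k)%N &
    forall j, (k <= j)%N -> (\rank (A ^+ k) <= \rank (A ^+ j))%N by exact: (H _ 2%N).
elim: r => [|r IH] k k2 kr.
  by exists k => // j _; move: kr; rewrite leqn0 => /eqP ->.
have [[j [kj jr]]|nj] := pselect (exists j, (k <= j)%N /\ (\rank (A ^+ j) < \rank (A ^+ k))%N).
  by apply: (IH j); [exact: leq_trans kj|rewrite -ltnS; exact: leq_trans kr].
exists k => // j kj; rewrite leqNgt; apply/negP => jk; apply: nj.
by exists j.
Qed.

(** [L] is studied through [D] on coordinates, where ranks are available. The hypothesis on cubes
    reduces the kernel of every power of [L] on the range of [tau] to the kernel of its square. *)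
Lemma fitting_decomposition :
  (forall v, L (L (L (tau v))) = 0 -> L (L (tau v)) = 0) ->
  let W := range tau in
  [/\ direct_sum W (ker2_on W L) (im2_on W L),
      invariant_under L (ker2_on W L),
      invariant_under L (im2_on W L),
      ker2_on W L = root_space0 W L
    & set_bij (im2_on W L) (im2_on W L) L].
Proof.
move=> K W.
pose Dl : {linear 'rV[R]_m -> 'rV[R]_m} := HB.pack D (GRing.isLinear.Build _ _ _ _ D D_lin).
pose taul : {linear 'rV[R]_m -> E} := HB.pack tau (GRing.isLinear.Build _ _ _ _ tau tau_lin).
have tau0 : tau 0 = 0 := linear0 taul.
have D0 : D 0 = 0 := linear0 Dl.
have L0 : L 0 = 0 by rewrite -tau0 LE D0.
have tauB u v : tau (u - v) = tau u - tau v := linearB taul u v.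
have tauD u v : tau (u + v) = tau u + tau v := linearD taul u v.
have DB u v : D (u - v) = D u - D v := linearB Dl u v.
have DD u v : D (u + v) = D u + D v := linearD Dl u v.
have iterL k v : iter k L (tau v) = tau (iter k D v).
  by elim: k => // k IH; rewrite !iterS IH LE.
have iterD k v : iter k D v = v *m (lin1_mx Dl) ^+ k.
  elim: k => [|k IH]; first by rewrite expr0 mulmx1.
  by rewrite iterS IH exprSr mulmxA mul_rV_lin1.
(* Two extra applications of [L] bring the exponent to at least 2; the hypothesis [K] then lowers it
   one by one down to 2. *)
have root k v : iter k L (tau v) = 0 -> L (L (tau v)) = 0.
  move=> h; have : iter k.+2 L (tau v) = 0 by rewrite !iterS h !L0.
  elim: k v {h} => // k IH v; rewrite iterSr LE => /IH.
  by rewrite -LE; exact: K.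
have LB u v : L (tau u - tau v) = L (tau u) - L (tau v).
  by rewrite -tauB !LE DB tauB.
(* Rank stability writes [D^k v] as [D^(2k) v']. Then [v - D^k v'] is killed by [D^k], so its image
   under [tau] is killed by the square of [L], while [D^k v'] lies in the image of the square of
   [D]. *)
have decomp v : exists v1 v2, [/\ v = v1 + D (D v2) & L (L (tau v1)) = 0].
  have [[|[|k]]// _ /(submx_trans (submxMl v _))/submxP[v' E']] := rank_power_stable (lin1_mx Dl).
  exists (v - D (D (iter k D v'))), (iter k D v'); split; first by rewrite subrK.
  have AA : lin1_mx Dl ^+ k.+2 *m lin1_mx Dl ^+ k.+2 = lin1_mx Dl ^+ (k.+2 + k.+2) by rewrite exprD.
  apply: (root k.+2); rewrite iterL iterD -[D (D _)]/(iter k.+2 D v') iterD.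
  rewrite mulmxBl E' -mulmxA AA subrr.
  exact: tau0.
have im2E u : im2_on W L u <-> exists v, u = tau (D (D v)).
  split; first by move=> [_ [v _ <-] <-]; exists v; rewrite !LE.
  by move=> [v ->]; exists (tau v); [exists v|rewrite !LE].
have ker2E u : ker2_on W L u <-> exists2 v, u = tau v & tau (D (D v)) = 0.
  split; first by move=> [[v _ <-]]; rewrite !LE => h; exists v.
  by move=> [v -> h]; split; [exists v|rewrite !LE].
have im2_inj v : L (tau (D (D v))) = 0 -> tau (D (D v)) = 0.
  by rewrite -!LE; exact: K.
split.
- split.
  + split; first by apply/ker2E; exists 0 => //; rewrite !D0.
    move=> a _ _ /ker2E[u -> hu] /ker2E[v -> hv]; apply/ker2E.
    by exists (a *: u + v); rewrite ?tau_lin// !D_lin tau_lin hu hv scaler0 addr0.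
  + split; first by apply/im2E; exists 0; rewrite !D0.
    move=> a _ _ /im2E[u ->] /im2E[v ->]; apply/im2E.
    by exists (a *: u + v); rewrite !D_lin tau_lin.
  + apply/seteqP; split=> [u [/ker2E[v -> hv] /im2E[w Ew]]|_ ->].
      (* An element of both spaces is the square of [L] applied to [tau w], so the fourth power of
         [L] kills [tau w]. *)
      have h4 : iter 4 L (tau w) = 0.
        by rewrite /= (LE w) (LE (D w)) -Ew !LE.
      by have := root 4 w h4; rewrite (LE w) (LE (D w)) -Ew.
    by split; [apply/ker2E|apply/im2E]; exists 0; rewrite ?D0.
  + apply/seteqP; split=> [_ [v _ <-]|_ [u [w [/ker2E[v -> _] /im2E[v' ->] ->]]]].
      have [v1 [v2 [Ev h1]]] := decomp v.
      exists (tau v1), (tau (D (D v2))); split; last by rewrite -tauD -Ev.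
        by apply/ker2E; exists v1 => //; rewrite -!LE.
      by apply/im2E; exists v2.
    by exists (v + D (D v')) => //; rewrite tauD.
- move=> _ /ker2E[v -> h]; apply/ker2E; exists (D v); first by rewrite LE.
  by rewrite -LE h L0.
- by move=> _ /im2E[v ->]; apply/im2E; exists (D v); rewrite LE.
- apply/seteqP; split=> [u [Wu h]|_ [[v _ <-] [k /root h]]]; first by split=> //; exists 2.
  by split=> //; exists v.
- split.
  + by move=> _ /im2E[v ->]; apply/im2E; exists (D v); rewrite LE.
  + move=> a b; rewrite !inE => /im2E[u ->] /im2E[v ->] Euv.
    apply/eqP; rewrite -subr_eq0 -tauB -!DB; apply/eqP/im2_inj.
    by rewrite !DB tauB LB Euv subrr.
  + move=> _ /im2E[v ->]; have [v1 [v2 [Ev h1]]] := decomp v.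
    (* Applying the square of [L] to the decomposition of [v] kills [v1] and leaves four
       applications of [D] to [v2]. *)
    exists (tau (D (D (D v2)))); first by apply/im2E; exists (D v2).
    by rewrite Ev !DD tauD LE -[tau (D (D v1))]LE -[tau (D v1)]LE h1 add0r.
Qed.

End Fitting.

(** * The metric, the bracket and a field of constant length *)

Lemma innerDl (R : realType) (M : Type) n (g : M -> 'M[R]_n) x u v w :
  inner g x (u + v) w = inner g x u w + inner g x v w.
Proof. by rewrite /inner !mulmxDl mxE. Qed.

Lemma innerZl (R : realType) (M : Type) n (g : M -> 'M[R]_n) x a u w :
  inner g x (a *: u) w = a * inner g x u w.
Proof. by rewrite /inner -!scalemxAl mxE. Qed.

Lemma innerNl (R : realType) (M : Type) n (g : M -> 'M[R]_n) x u w :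
  inner g x (- u) w = - inner g x u w.
Proof. by rewrite -scaleN1r innerZl mulN1r. Qed.

Lemma vbracket_anti (R : realType) (M : Type) n (c : M -> chart R M n) X Y :
  vbracket c X Y = - vbracket c Y X.
Proof. by apply/funext => x; rewrite /vbracket fctE opprB. Qed.

(* The Killing fields enter only through [tau], [ad] and the derivation property
   of the metric; the field of constant length is [tau U0]. *)
Section ConstantLength.
Context (R : realType) (m n : nat) (M : Type) (cM : M -> chart R M n) (g : M -> 'M[R]_n).
Variables (tau : 'rV[R]_m -> vfield R M n) (ad : 'rV[R]_m -> 'rV[R]_m -> 'rV[R]_m).
Variables (br : vfield R M n -> vfield R M n -> vfield R M n) (U0 : 'rV[R]_m).
Local Notation gg := (range tau).
Local Notation L := (br (tau U0)).
Hypotheses (Hg : is_riemannian_metric cM g)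
  (tau_lin : forall a V W, tau (a *: V + W) = a *: tau V + tau W)
  (ad_lin : forall U a V W, ad U (a *: V + W) = a *: ad U V + ad U W)
  (br_anti : forall A B, br A B = - br B A)
  (bracketE : forall U V, br (tau U) (tau V) = - tau (ad U V))
  (derivation : forall U V W r, (forall y, inner g y (tau V y) (tau W y) = r) ->
     forall x, inner g x (tau (ad U V) x) (tau W x) + inner g x (tau V x) (tau (ad U W) x) = 0)
  (X_len : constant_length g (tau U0)).

Let symg x u v : inner g x u v = inner g x v u. Proof. exact: (Defs.metric_sym Hg). Qed.

Let ad_anti U V : tau (ad U V) = - tau (ad V U).
Proof. by rewrite -[RHS]bracketE br_anti bracketE opprK. Qed.

Let tau0 : tau 0 = 0.
Proof. by have := tau_lin (-1) 0 0; rewrite scaler0 addr0 scaleN1r addNr. Qed.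

Lemma bracket_tau V : L (tau V) = tau (- ad U0 V).
Proof.
have := tau_lin (-1) (ad U0 V) 0; rewrite tau0 !addr0 !scaleN1r => ->.
exact: bracketE.
Qed.

Let ad_U0 V : tau (ad V U0) = L (tau V).
Proof. by rewrite ad_anti bracketE. Qed.

(** The derivation property for the constant squared length of [tau U0] gives twice this product. *)
Let inner_bracket V x : inner g x (L (tau V) x) (tau U0 x) = 0.
Proof.
have [r gr] := X_len.
have := derivation V gr x; rewrite ad_U0 [X in _ + X]symg => /eqP.
by rewrite -mulr2n mulrn_eq0/= => /eqP.
Qed.

(** By [inner_bracket] the product of [L (tau A)] with [tau U0] is constantly 0, so the derivation
    property applies to it once more, now along [Z]. *)
Let inner_bracket2 A Z x :
  inner g x (tau (ad Z (- ad U0 A)) x) (tau U0 x) = - inner g x (L (tau A) x) (L (tau Z) x).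
Proof.
have h : forall y, inner g y (tau (- ad U0 A) y) (tau U0 y) = 0.
  by move=> y; rewrite -bracket_tau inner_bracket.
have := derivation Z h x; rewrite ad_U0 -bracket_tau => /eqP.
by rewrite addr_eq0 => /eqP.
Qed.

(* g([LB,LA],X) is computed in two ways. *)
Lemma bracket_identity A B x : gg A -> gg B ->
  inner g x (L A x) (L (L B) x) + inner g x (L B x) (L (L A) x) = 0.
Proof.
move=> [a _ <-] [b _ <-].
have h1 := inner_bracket2 a (- ad U0 b) x; have h2 := inner_bracket2 b (- ad U0 a) x.
rewrite ad_anti -[(- _) x]/(- _) innerNl h2 opprK in h1.
by rewrite -!bracket_tau in h1; rewrite h1 subrr.
Qed.

(** With [L (tau V)] as second argument, [bracket_identity] leaves the squared length of
    [L (L (tau V))]; positivity concludes pointwise. *)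
Lemma bracket_cubed V : L (L (L (tau V))) = 0 -> L (L (tau V)) = 0.
Proof.
move=> h3; apply/funext => x; apply/eqP; apply: contraT => /(Defs.metric_pos Hg x).
have gV : gg (tau V) by exists V.
have gLV : gg (L (tau V)) by rewrite bracket_tau; exists (- ad U0 V).
have := bracket_identity x gV gLV; rewrite h3.
have -> : inner g x (L (tau V) x) ((0 : M -> 'rV[R]_n) x) = 0.
  by rewrite symg /inner !mul0mx mxE.
by rewrite add0r => ->; rewrite ltxx.
Qed.

Lemma L_linear a A B : gg A -> gg B -> L (a *: A + B) = a *: L A + L B.
Proof.
move=> [V _ <-] [W _ <-]; rewrite -tau_lin !bracketE ad_lin tau_lin.
by rewrite opprD scalerN.
Qed.

Lemma gg_linear a A B : gg A -> gg B -> gg (a *: A + B).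
Proof. by move=> [V _ <-] [W _ <-]; rewrite -tau_lin; exists (a *: V + W). Qed.

(** [U] and [V] have preimages [A] and [B] under [L], so [bracket_identity] at the pairs [(A, A)],
    [(B, B)] and [(A, B)] yields the three relations in turn. *)
Lemma eigen_relations (alpha beta : R) U V : gg U -> gg V ->
  alpha ^+ 2 + beta ^+ 2 != 0 ->
  L U = alpha *: U - beta *: V -> L V = beta *: U + alpha *: V ->
  forall x, [/\ alpha * inner g x (U x) (U x) = beta * inner g x (U x) (V x),
    alpha * inner g x (V x) (V x) = - (beta * inner g x (U x) (V x))
  & beta * (inner g x (U x) (U x) - inner g x (V x) (V x)) = - (2 * alpha * inner g x (U x) (V x))].
Proof.
move=> gU gV d0 LU LV x; set d := alpha ^+ 2 + beta ^+ 2 in d0.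
have gg0 : gg 0 by exists 0.
have L0 : L 0 = 0 by have := L_linear (-1) gg0 gg0; rewrite scaler0 addr0 scaleN1r addNr.
have ggZ a A : gg A -> gg (a *: A) by move=> gA; rewrite -[_ *: _]addr0; exact: gg_linear.
have LZ a A : gg A -> L (a *: A) = a *: L A.
  by move=> gA; rewrite -[_ *: A]addr0 L_linear// L0 addr0.
(* The coefficients come from inverting the 2 by 2 matrix of [L] on [U] and [V], whose determinant
   is [d]. *)
pose A := (alpha / d) *: U + (beta / d) *: V.
pose B := (- (beta / d)) *: U + (alpha / d) *: V.
have gA : gg A by apply: gg_linear => //; exact: ggZ.
have gB : gg B by apply: gg_linear => //; exact: ggZ.
have comb (a b : R) (P Q : M -> 'rV[R]_n) y i : (a *: P + b *: Q) y 0 i = a * P y 0 i + b * Q y 0 i.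
  by rewrite !fctE !mxE.
have combN (a b : R) (P Q : M -> 'rV[R]_n) y i :
    (a *: P - b *: Q) y 0 i = a * P y 0 i - b * Q y 0 i.
  by rewrite !fctE !mxE.
have LA : L A = U.
  rewrite L_linear ?LZ//; last exact: ggZ.
  apply/funext => y; apply/rowP => i; rewrite comb LU LV comb combN /d.
  by field.
have LB : L B = V.
  rewrite L_linear ?LZ//; last exact: ggZ.
  apply/funext => y; apply/rowP => i; rewrite comb LU LV comb combN /d.
  by field.
have h1 := bracket_identity x gA gA; have h2 := bracket_identity x gB gB.
have h3 := bracket_identity x gA gB.
rewrite LA LB LU LV in h1 h2 h3.
have E (a b : R) (P Q W : 'rV[R]_n) :
    inner g x P (a *: Q + b *: W) = a * inner g x P Q + b * inner g x P W.
  by rewrite symg innerDl !innerZl (symg x Q) (symg x W).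
have EU : (alpha *: U - beta *: V) x = alpha *: U x + (- beta) *: V x by rewrite !fctE scaleNr.
have EV : (beta *: U + alpha *: V) x = beta *: U x + alpha *: V x by [].
rewrite EU E in h1; rewrite EV E (symg x (V x)) in h2; rewrite EU EV !E (symg x (V x)) in h3.
by split; lra.
Qed.

(** The first two relations add up to [alpha] times the sum of the squared lengths being 0; if
    [alpha] were nonzero, both fields would vanish everywhere. The case [beta = 0] of real
    eigenvalues is included. *)
Lemma eigen_real_part (alpha beta : R) U V : gg U -> gg V -> U <> 0 \/ V <> 0 ->
  L U = alpha *: U - beta *: V -> L V = beta *: U + alpha *: V -> alpha = 0.
Proof.
move=> gU gV nz LU LV; apply/eqP; apply: contraT => a0.
have d0 : alpha ^+ 2 + beta ^+ 2 != 0.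
  by rewrite paddr_eq0 ?sqr_ge0// sqrf_eq0 (negPf a0).
have nn x w : 0 <= inner g x w w.
  have [->|/(Defs.metric_pos Hg x)/ltW//] := eqVneq w 0.
  by rewrite /inner !mul0mx mxE.
have UV0 x : U x = 0 /\ V x = 0.
  have [h1 h2 _] := eigen_relations gU gV d0 LU LV x.
  have : alpha * (inner g x (U x) (U x) + inner g x (V x) (V x)) = 0.
    by rewrite mulrDr h1 h2 subrr.
  move/eqP; rewrite mulf_eq0 (negPf a0)/= paddr_eq0// => /andP[/eqP hU /eqP hV].
  by split; apply/eqP; apply: contraT => /(Defs.metric_pos Hg x); rewrite (hU, hV) ltxx.
by case: nz => -[]; apply/funext => x; have [] := UV0 x.
Qed.

End ConstantLength.

Theorem theorem3 (R : realType)
  (m : nat) (G : topGroupType) (cG : G -> chart R G m) (e : 'rV[R]_m -> G)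
  (n : nat) (M : topologicalType) (cM : M -> chart R M n) (g : M -> 'M[R]_n)
  (act : G -> M -> M)
  (HG : is_lie_group cG) (He : is_lie_exp cG e)
  (HM : is_manifold cM) (Mconn : connected [set: M])
  (Hg : is_riemannian_metric cM g)
  (Hact : is_smooth_action cG cM act)
  (Heff : effective_action act)
  (Hiso : isometric_action cM g act)
  (X : M -> 'rV[R]_n)
  (HX : lie_algebra e cM act X)
  (HXlen : constant_length g X) :
  let gg : set (M -> 'rV[R]_n) := lie_algebra e cM act in
  let L : (M -> 'rV[R]_n) -> (M -> 'rV[R]_n) := vbracket cM X in
  let A1 := ker2_on gg L in
  let A2 := im2_on gg L in
  [/\ [/\ direct_sum gg A1 A2,
          invariant_under L A1,
          invariant_under L A2,
          A1 = root_space0 gg L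
        & set_bij A2 A2 L],
      forall (o : set (M -> 'rV[R]_n)) (alpha beta : R) (U V : M -> 'rV[R]_n),
        o `<=` gg -> two_dimensional o -> invariant_under L o ->
        beta != 0 ->
        o U -> o V -> U <> 0 -> V <> 0 ->
        L U = alpha *: U - beta *: V ->
        L V = beta *: U + alpha *: V ->
        [/\ alpha = 0,
            forall x, inner g x (U x) (V x) = 0
          & forall x, inner g x (U x) (U x) = inner g x (V x) (V x)]
    & forall z : R[i], complex_eigenvalue gg L z -> complex.Re z = 0].
Proof.
have [U0 _ EX] := HX; rewrite -{X HX}EX in HXlen *.
have lin := fundamental_field_linear HG He HM Hact.
have adl := ad_linear HG He.
have brE := vbracket_fundamental HG He HM Hact.
have anti := @vbracket_anti _ _ _ cM.
have der := inner_fundamental_cst HG He HM Hact Hiso.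
have real_part := eigen_real_part Hg lin adl anti brE der HXlen.
(* The operator matching [L] on coordinates is the opposite of [ad cG e U0], with the sign of
   [vbracket_fundamental]. *)
have D_lin a V W : - ad cG e U0 (a *: V + W) = a *: - ad cG e U0 V + - ad cG e U0 W.
  by rewrite adl opprD scalerN.
have LE := bracket_tau U0 lin brE.
move=> gg L A1 A2; split.
- apply: (@fitting_decomposition _ _ _ _ (fun V => - ad cG e U0 V) _ lin D_lin
    LE) => V.
  exact: (bracket_cubed Hg lin anti brE der HXlen).
- move=> o alpha beta U V oW _ _ b0 oU oV nzU _ LU LV.
  have gU := oW _ oU; have gV := oW _ oV.
  have a0 : alpha = 0 by apply: (real_part _ _ _ _ gU gV _ LU LV); left.
  have d0 : alpha ^+ 2 + beta ^+ 2 != 0 by rewrite a0 expr0n add0r sqrf_eq0.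
  have rel := eigen_relations Hg lin adl anti brE der HXlen gU gV d0 LU LV.
  (* Since [alpha = 0], the first and third relations become [beta] times the two quantities that
     must vanish. *)
  split=> // x; have [h1 _ h3] := rel x.
    by apply/eqP; move/esym/eqP: h1; rewrite a0 mul0r mulf_eq0 (negPf b0).
  move/eqP: h3; rewrite a0 mulr0 mul0r oppr0 mulf_eq0 (negPf b0)/= subr_eq0.
  by move/eqP.
- by move=> z [U [V [gU gV nz LU LV]]]; exact: real_part gU gV nz LU LV.
Qed.
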